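(* Let $d\ge0$ and $l\ge1$ be integers, $\alpha_1,\dots,\alpha_d\in\mathbb{C}$, $i\in\{0,\dots,l-1\}$, and assume that none of the entries of the list $\hat S(i)$ is a non-positive integer. For $m\ge0$ and $n=ml+i$ let $$Q_n(x)=x^i\;{}_1F_{ld+l-1}\left[\begin{matrix}-m\\ \hat S(i)\end{matrix};-x^l\right]$$ (up to multiplicative constants these are the $d$-orthogonal polynomials $e^{G^l}x^n$, $G=\rho\prod_{j=1}^d(x\partial_x+\alpha_j+1)\partial_x$, with $\rho\, l^{d+1}=1$). Then for every $x\in\mathbb{C}$ the following Mehler--Heine type formula holds, where $n=ml+i$: $$\lim_{m\to\infty}m^{i/l}\,Q_n\bigl(x/m^{1/l}\bigr)=x^i\;{}_0F_{ld+l-1}\left[\begin{matrix}-\\ \hat S(i)\end{matrix};x^l\right].$$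
   Context: Put $\alpha_{d+1}=0$ and, for $i\in\{0,\dots,l-1\}$, $1\le k\le d+1$, $0\le r\le l-1$, put $S_{k,r}(i)=\frac{\alpha_k+i-r}{l}+1$. Note $S_{d+1,i}(i)=1$. Let $\hat S(i)$ be the list (with multiplicity) of the $ld+l-1$ numbers $S_{k,r}(i)$ over all pairs $(k,r)$ with $1\le k\le d+1$, $0\le r\le l-1$, except $(k,r)=(d+1,i)$. Pochhammer symbol: $(a)_0=1$, $(a)_j=a(a+1)\cdots(a+j-1)$. Generalized hypergeometric series: ${}_pF_q\left[\begin{matrix}a_1,\dots,a_p\\ b_1,\dots,b_q\end{matrix};z\right]=\sum_{j\ge0}\frac{(a_1)_j\cdots(a_p)_j}{(b_1)_j\cdots(b_q)_j}\frac{z^j}{j!}$, with ''$-$'' denoting an empty list. $m^{1/l}$ denotes the positive real root. *)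

(* Defs.v *)
(* Stdlib reals; complex numbers, series and limits from Coquelicot. *)
From Stdlib Require Import Reals List Arith ZArith.
From Coquelicot Require Import Coquelicot.
Import ListNotations.
Local Open Scope C_scope.

Fixpoint poch (a : C) (j : nat) : C :=
  match j with
  | O => 1
  | S j' => poch a j' * (a + INR j')
  end.

Definition Cprod (s : list C) : C := fold_right Cmult 1 s.

Definition pFq_term (a b : list C) (z : C) (j : nat) : C :=
  Cprod (map (fun c => poch c j) a) / Cprod (map (fun c => poch c j) b)
  * (z ^ j / INR (fact j)).

(* Sum of the hypergeometric series; an unspecified value if it diverges
   (same convention as [RInt]). *)
Definition pFq (a b : list C) (z : C) : C :=
  iota (is_series (V := C_CompleteNormedModule) (pFq_term a b z)).

Lemma pFq_unique (a b : list C) (z s : C) :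
  is_series (V := C_NormedModule) (pFq_term a b z) s -> pFq a b z = s.
Proof.
exact (iota_filterlim_locally (V := C_CompleteNormedModule) _ s).
Qed.

(* The parameters are [alpha 1], ..., [alpha d]; index [d + 1] is reset to 0
   and all other values of [alpha] are ignored. *)
Definition alpha_ext (d : nat) (alpha : nat -> C) (k : nat) : C :=
  if (k =? d + 1)%nat then 0 else alpha k.

Definition S_kr (d l : nat) (alpha : nat -> C) (k r i : nat) : C :=
  (alpha_ext d alpha k + INR i - INR r) / INR l + 1.

Definition S_hat (d l : nat) (alpha : nat -> C) (i : nat) : list C :=
  map (fun p => S_kr d l alpha (fst p) (snd p) i)
    (filter (fun p => negb ((fst p =? d + 1)%nat && (snd p =? i)%nat))
       (list_prod (seq 1 (d + 1)) (seq 0 l))).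

Definition nonpos_integer (z : C) : Prop :=
  exists k : Z, (k <= 0)%Z /\ z = IZR k.

(* [m] and [i] are recovered from [n = m * l + i], [i < l], by Euclidean
   division. *)
Definition Q_poly (d l : nat) (alpha : nat -> C) (n : nat) (x : C) : C :=
  let m := (n / l)%nat in
  let i := (n mod l)%nat in
  x ^ i * pFq [- RtoC (INR m)] (S_hat d l alpha i) (- x ^ l).

(* Main.v *)
Require Import Defs.
From Stdlib Require Import Reals List Arith Lia Lra.
From Coquelicot Require Import Coquelicot.
Import ListNotations.
Local Open Scope C_scope.

(** Write [S] for the list of lower parameters and [z = x ^ l]. For [m >= 1]
    the powers of [m] are exact: [m^(i/l)] cancels the denominator of
    [(x / m^(1/l)) ^ i], and [(x / m^(1/l)) ^ l = z / m]. What remains is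
    [x ^ i] times [1Fq(-m; S; -z/m)], so the theorem reduces to the confluence
    of this function to [0Fq(S; z)] as [m] tends to infinity
    ([pFq_confluence]).

    The [j]-th term of [1Fq(-m; S; -z/m)] is the [j]-th term of [0Fq(S; z)]
    times [(-m)_j (-1/m)^j], the product of [1 - k/m] over [k < j]
    ([pFq_term_damping]). This factor lies between 0 and 1 (it vanishes for
    [j > m], where the polynomial has ended) and tends to 1 for each fixed [j].
    Hence the limit may be taken term by term, by dominated convergence for
    series ([tannery]), as soon as the limit series converges absolutely.
    It does, even for empty [S]: since no entry of [S] is a non-positive
    integer, the products of the Pochhammer symbols of the entries are bounded
    away from 0 ([Cprod_poch_bounded_below]), and the factor [z ^ j / j!] is
    summable. *)

(** * Dominated convergence for series *)

(** Domination makes the partial sums converge uniformly in [t] (Weierstrass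
    M-test), and a uniform limit may be exchanged with a limit along [Phi]. *)
Lemma tannery {K : AbsRing} {V : CompleteNormedModule K} {T : Type}
  (Phi : (T -> Prop) -> Prop) {FPhi : ProperFilter Phi}
  (f : T -> nat -> V) (g : nat -> V) (M : nat -> R) (F : T -> V) (G : V) :
  ex_series M ->
  (forall t j, (norm (f t j) <= M j)%R) ->
  (forall j, filterlim (fun t => f t j) Phi (locally (g j))) ->
  (forall t, is_series (f t) (F t)) ->
  is_series g G ->
  filterlim F Phi (locally G).
Proof.
  intros hM hle hlim hF hG.
  set (P := fun n t => sum_n (f t) n).
  (* The M-test: the partial sums are Cauchy for the sup norm over [T]. *)
  assert (hunif : exists Y : fct_UniformSpace T V,
            filterlim (P : nat -> fct_UniformSpace T V) eventually (locally Y)).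
  { apply (filterlim_locally_cauchy
             (U := @fct_CompleteSpace T V) (F := eventually)).
    intros eps.
    destruct (Cauchy_ex_series (V := R_CompleteNormedModule) M hM eps) as [N hN].
    assert (hball : forall p q, (N <= p)%nat -> (p <= q)%nat -> forall t,
               ball (P p t) eps (P q t)).
    { intros p q hp hpq t.
      apply (norm_compat1 (V := V)).
      unfold P.
      eapply Rle_lt_trans;
        [apply Req_le, f_equal, eq_sym, (sum_n_m_sum_n (f t) p q hpq) |].
      eapply Rle_lt_trans; [apply (norm_sum_n_m (V := V)) |].
      eapply Rle_lt_trans; [apply sum_n_m_le; intros k; apply hle |].
      eapply Rle_lt_trans; [apply Rle_abs |].
      apply (hN (S p) q); lia. }
    exists (fun n => (N <= n)%nat). split.
    - exists N; auto.
    - intros u v hu hv t.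
      destruct (Nat.le_ge_cases u v) as [h | h].
      + now apply hball.
      + apply ball_sym. now apply hball. }
  destruct hunif as [Y hY].
  destruct (filterlim_switch eventually _ Phi _ P Y (sum_n g) hY)
    as [L [hL1 hL2]].
  - intros n. unfold P. induction n as [| n IHn].
    + apply filterlim_ext with (fun t => f t O).
      * intros t. now rewrite sum_O.
      * rewrite sum_O. apply hlim.
    + apply filterlim_ext with (fun t => plus (sum_n (f t) n) (f t (S n))).
      * intros t. now rewrite sum_Sn.
      * rewrite sum_Sn.
        eapply filterlim_comp_2;
          [exact IHn | apply hlim | apply (filterlim_plus (V := V))].
  - rewrite (filterlim_locally_unique (F := eventually) (sum_n g) G L hG hL1).
    apply filterlim_ext with Y; [| exact hL2].
    (* The uniform limit [Y] is also the pointwise one, hence equals [F]. *)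
    intros t.
    apply (filterlim_locally_unique (F := eventually) (sum_n (f t)));
      [| exact (hF t)].
    apply filterlim_locally. intros eps.
    destruct (proj1 (filterlim_locally (F := eventually) P Y) hY eps) as [N hN].
    exists N. intros n hn. apply (hN n hn t).
Qed.

(** * Summability of the limit series *)

Lemma poch_neq_0 (s : C) (j : nat) : ~ nonpos_integer s -> poch s j <> 0.
Proof.
  intros hs. induction j as [| j IHj]; cbn [poch].
  - apply C1_nz.
  - apply Cmult_neq_0; [exact IHj |].
    intros h. apply hs. exists (- Z.of_nat j)%Z. split; [lia |].
    rewrite opp_IZR, <- INR_IZR_INZ, RtoC_opp.
    replace s with (s + INR j - INR j) by ring. rewrite h. ring.
Qed.

(** [poch s j] never vanishes, and once [j >= Cmod s + 1] each further factor
    has modulus at least 1; so only finitely many indices matter. *)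
Lemma poch_bounded_below (s : C) :
  ~ nonpos_integer s ->
  exists c : R, (0 < c)%R /\ forall j, (c <= Cmod (poch s j))%R.
Proof.
  intros hs.
  assert (hfin : forall N, exists c : R, (0 < c)%R /\
            forall j, (j <= N)%nat -> (c <= Cmod (poch s j))%R).
  { induction N as [| N [c [hc hcN]]].
    - exists 1%R. split; [lra |]. intros j hj.
      replace j with O by lia. cbn. rewrite Cmod_1. lra.
    - exists (Rmin c (Cmod (poch s (S N)))). split.
      + apply Rmin_glb_lt; [exact hc |].
        apply Cmod_gt_0, poch_neq_0, hs.
      + intros j hj.
        destruct (Nat.eq_dec j (S N)) as [-> | hne]; [apply Rmin_r |].
        eapply Rle_trans; [apply Rmin_l | apply hcN; lia]. }
  destruct (INR_unbounded (Cmod s + 1)) as [N hN].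
  destruct (hfin N) as [c [hc hcN]].
  exists c. split; [exact hc |].
  intros j. induction j as [| j IHj]; [apply hcN; lia |].
  destruct (Nat.le_gt_cases (S j) N) as [h | h]; [now apply hcN |].
  cbn [poch]. rewrite Cmod_mult.
  assert (h1 : (1 <= Cmod (s + INR j))%R).
  { assert (htri : (Cmod (INR j) <= Cmod (s + INR j) + Cmod s)%R).
    { pose proof (Cmod_triangle (s + INR j) (- s)) as h1.
      rewrite Cmod_opp in h1.
      now replace (s + INR j + - s) with (RtoC (INR j)) in h1 by ring. }
    rewrite Cmod_R, Rabs_pos_eq in htri by apply pos_INR.
    assert (hj : (INR N <= INR j)%R) by (apply le_INR; lia).
    lra. }
  pose proof (Cmod_ge_0 (poch s j)). nra.
Qed.

Lemma Cprod_poch_bounded_below (b : list C) :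
  (forall s, In s b -> ~ nonpos_integer s) ->
  exists c : R, (0 < c)%R /\
    forall j, (c <= Cmod (Cprod (map (fun s => poch s j) b)))%R.
Proof.
  induction b as [| s b IHb]; intros hb.
  - exists 1%R. split; [lra |]. intros j. cbn. rewrite Cmod_1. lra.
  - destruct IHb as [c [hc hcb]]; [intros t ht; apply hb; now right |].
    destruct (poch_bounded_below s) as [c' [hc' hcs]]; [apply hb; now left |].
    exists (c' * c)%R. split; [now apply Rmult_lt_0_compat |].
    intros j. cbn [map Cprod fold_right]. rewrite Cmod_mult.
    apply Rmult_le_compat; [lra | lra | apply hcs | apply hcb].
Qed.

(** The denominators stay away from 0, so the terms are dominated by those of
    the exponential series. A bound this crude suffices for every length of
    [b], the empty list included. *)
Lemma ex_series_norm_pFq_0 (b : list C) (z : C) :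
  (forall s, In s b -> ~ nonpos_integer s) ->
  ex_series (fun j => Cmod (pFq_term [] b z j)).
Proof.
  intros hb.
  destruct (Cprod_poch_bounded_below b hb) as [c [hc hcb]].
  apply (ex_series_le (V := R_CompleteNormedModule) _
           (fun j => / c * (Cmod z ^ j * / INR (fact j)))%R).
  - intros j. change (norm ?u) with (Rabs u).
    rewrite Rabs_pos_eq by apply Cmod_ge_0.
    unfold pFq_term. specialize (hcb j).
    assert (hB : Cprod (map (fun s => poch s j) b) <> 0)
      by (apply Cmod_gt_0; lra).
    assert (hf : RtoC (INR (fact j)) <> 0).
    { intros h. apply (INR_fact_neq_0 j). now apply RtoC_inj. }
    rewrite Cmod_mult, !Cmod_div, Cmod_pow, Cmod_R by assumption.
    rewrite (Rabs_pos_eq (INR _)) by apply pos_INR.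
    cbn [map Cprod fold_right]. rewrite Cmod_1.
    apply Rmult_le_compat_r.
    + apply Rmult_le_pos; [apply pow_le, Cmod_ge_0 |].
      apply Rlt_le, Rinv_0_lt_compat, INR_fact_lt_0.
    + unfold Rdiv. rewrite Rmult_1_l. now apply Rinv_le_contravar.
  - apply (ex_series_scal_l (K := R_AbsRing) (/ c)%R
             (fun j => Cmod z ^ j * / INR (fact j))%R).
    exists (exp (Cmod z)).
    apply is_series_ext with (2 := is_exp_Reals (Cmod z)).
    intros j. cbn. unfold scal; cbn. unfold mult; cbn.
    now rewrite pow_n_pow.
Qed.

Lemma is_series_pFq (a b : list C) (z : C) :
  ex_series (V := C_NormedModule) (pFq_term a b z) ->
  is_series (V := C_NormedModule) (pFq_term a b z) (pFq a b z).
Proof.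
  intros [s hs]. now rewrite (pFq_unique a b z s hs).
Qed.

(** * The damping factors *)

(** For [m >= 1] this is the product of [1 - k / m] over [k < j], that is
    [(-m)_j (-1/m)^j]. The factors are written [(m - k) / m] so that [damping m]
    vanishes beyond [m] even when [m = 0], where division by zero gives 0. *)
Fixpoint damping (m j : nat) : R :=
  match j with
  | O => 1
  | S j' => damping m j' * ((INR m - INR j') / INR m)
  end%R.

Lemma damping_eq_0 (m j : nat) : (m < j)%nat -> damping m j = 0%R.
Proof.
  induction j as [| j IHj]; intros hj; [lia |].
  cbn [damping]. destruct (Nat.eq_dec m j) as [-> | hne].
  - unfold Rdiv. rewrite Rminus_diag. ring.
  - rewrite IHj by lia. ring.
Qed.

(** The powers of [-1/m] from the argument are absorbed by the Pochhammer symbol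
    of the numerator parameter [-m], which leaves the term of the limit
    series times a real factor. *)
Lemma pFq_term_damping (b : list C) (z : C) (m j : nat) :
  pFq_term [- RtoC (INR m)] b (- (z / INR m)) j =
  damping m j * pFq_term [] b z j.
Proof.
  assert (h : poch (- RtoC (INR m)) j * (- (z / INR m)) ^ j =
              RtoC (damping m j) * z ^ j).
  { induction j as [| j IHj]; cbn [poch damping].
    - simpl. ring.
    - rewrite !Cpow_S.
      transitivity ((poch (- RtoC (INR m)) j * (- (z / INR m)) ^ j) *
                    ((- RtoC (INR m) + INR j) * - (z / INR m))); [ring |].
      rewrite IHj. destruct m as [| m].
      (* For [m = 0] both sides vanish, whatever the value of [z / 0]. *)
      + destruct j as [| j].
        * cbn [damping INR]. rewrite RtoC_mult.
          unfold Rdiv; rewrite Rminus_0_r, Rmult_0_l. ring.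
        * rewrite (damping_eq_0 0 (S j)), Rmult_0_l by lia. ring.
      + rewrite RtoC_mult, RtoC_div, RtoC_minus
          by (apply not_0_INR; lia).
        field. intros h. apply RtoC_inj in h. revert h. apply not_0_INR; lia. }
  unfold pFq_term, Cdiv. cbn [map Cprod fold_right].
  transitivity ((poch (- RtoC (INR m)) j * (- (z / INR m)) ^ j) *
                / Cprod (map (fun c => poch c j) b) * / INR (fact j)).
  - unfold Cdiv. ring.
  - rewrite h. ring.
Qed.

Lemma damping_le_1 (m j : nat) : (Rabs (damping m j) <= 1)%R.
Proof.
  destruct (Nat.le_gt_cases j m) as [hjm | hjm].
  - induction j as [| j IHj]; cbn [damping].
    + rewrite Rabs_R1. lra.
    + rewrite Rabs_mult.
      assert (hm : (0 < INR m)%R) by (apply lt_0_INR; lia).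
      assert (hj : (INR j <= INR m)%R) by (apply le_INR; lia).
      pose proof (pos_INR j).
      rewrite (Rabs_pos_eq (_ / _)) by (apply Rdiv_le_0_compat; lra).
      rewrite <- (Rmult_1_r 1).
      apply Rmult_le_compat; [apply Rabs_pos | | apply IHj; lia |].
      * apply Rdiv_le_0_compat; lra.
      * apply Rle_div_l; lra.
  - rewrite (damping_eq_0 m j hjm), Rabs_R0. lra.
Qed.

Lemma damping_lim (j : nat) : is_lim_seq (fun m => damping m j) 1%R.
Proof.
  induction j as [| j IHj]; cbn [damping].
  - apply is_lim_seq_const.
  - apply (is_lim_seq_mult _ _ 1%R 1%R); [exact IHj | |].
    + apply is_lim_seq_ext_loc with (fun m => 1 - INR j * / INR m)%R.
      * exists 1%nat. intros m hm. field. apply not_0_INR; lia.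
      * replace (Finite 1) with (Rbar_plus 1%R (Rbar_opp (Rbar_mult (INR j) 0%R)))
          by (cbn; f_equal; ring).
        apply is_lim_seq_minus'; [apply is_lim_seq_const |].
        apply (is_lim_seq_scal_l _ (INR j) 0%R).
        apply (is_lim_seq_inv INR p_infty); [apply is_lim_seq_INR | easy].
    + cbn. unfold is_Rbar_mult; cbn. do 2 f_equal. ring.
Qed.

(** * The limit *)

(** The confluence of [1Fq(-m; b; -z/m)] to [0Fq(b; z)], with the terms of the
    limit series themselves as majorant. *)
Lemma pFq_confluence (b : list C) (z : C) :
  (forall s, In s b -> ~ nonpos_integer s) ->
  filterlim (fun m : nat => pFq [- RtoC (INR m)] b (- (z / INR m))) eventually
    (locally (pFq [] b z)).
Proof.
  intros hb.
  pose proof (ex_series_norm_pFq_0 b z hb) as hM.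
  assert (hle : forall m j,
             (Cmod (pFq_term [- RtoC (INR m)] b (- (z / INR m)) j)%C <=
              Cmod (pFq_term [] b z j))%R).
  { intros m j. rewrite pFq_term_damping, Cmod_mult, Cmod_R.
    rewrite <- (Rmult_1_l (Cmod (pFq_term [] b z j))) at 2.
    apply Rmult_le_compat_r; [apply Cmod_ge_0 | apply damping_le_1]. }
  apply (tannery (V := C_CompleteNormedModule) eventually
           (fun m => pFq_term [- RtoC (INR m)] b (- (z / INR m)))
           (pFq_term [] b z) (fun j => Cmod (pFq_term [] b z j))).
  - exact hM.
  - exact hle.
  - intros j.
    apply (filterlim_ext
             (fun m => scal (V := C_R_NormedModule) (damping m j)
                         (pFq_term [] b z j))).
    + intros m. rewrite pFq_term_damping. apply scal_R_Cmult.
    + (* The factor is real, so [C] is used here as a module over [R]. *)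
      pose proof (filterlim_scal_l (V := C_R_NormedModule) 1%R
                    (pFq_term [] b z j)) as hscal.
      rewrite (scal_one (V := C_R_NormedModule)) in hscal.
      exact (filterlim_comp _ _ _ _ _ _ _ _ (damping_lim j) hscal).
  - intros m. apply is_series_pFq.
    apply (ex_series_le (V := C_CompleteNormedModule) _ _ (hle m) hM).
  - apply is_series_pFq.
    apply (ex_series_le (V := C_CompleteNormedModule) _
             (fun j => Cmod (pFq_term [] b z j))); [| exact hM].
    intros j. apply Rle_refl.
Qed.

Theorem theorem5p3 (d l : nat) (hl : (1 <= l)%nat) (alpha : nat -> C)
  (i : nat) (hi : (i < l)%nat)
  (hS : forall s : C, In s (S_hat d l alpha i) -> ~ nonpos_integer s) (x : C) :
  filterlim
    (fun m : nat =>
       RtoC (Rpower (INR m) (INR i / INR l)) *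
       Q_poly d l alpha (m * l + i) (x / RtoC (Rpower (INR m) (/ INR l))))
    eventually
    (locally (x ^ i * pFq [] (S_hat d l alpha i) (x ^ l))).
Proof.
  apply (filterlim_ext_loc
           (fun m => x ^ i *
              pFq [- RtoC (INR m)] (S_hat d l alpha i) (- (x ^ l / INR m)))).
  - exists 1%nat. intros m hm.
    assert (hm0 : (0 < INR m)%R) by (apply lt_0_INR; lia).
    assert (hl0 : INR l <> 0%R) by (apply not_0_INR; lia).
    unfold Q_poly.
    rewrite (Nat.add_comm (m * l) i), Nat.div_add, Nat.Div0.mod_add,
      Nat.div_small, Nat.mod_small, Nat.add_0_l by lia.
    assert (hroot : forall k, (Rpower (INR m) (/ INR l) ^ k)%R =
                              Rpower (INR m) (INR k / INR l)).
    { intros k. rewrite <- Rpower_pow by apply exp_pos.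
      rewrite Rpower_mult. f_equal. field. exact hl0. }
    assert (hnz : forall k, RtoC (Rpower (INR m) (INR k / INR l)) <> 0).
    { intros k h. apply RtoC_inj in h. revert h.
      apply Rgt_not_eq, exp_pos. }
    assert (hdiv : forall k, (x / RtoC (Rpower (INR m) (/ INR l))) ^ k =
                             x ^ k / RtoC (Rpower (INR m) (INR k / INR l))).
    { intros k. unfold Cdiv.
      rewrite Cpow_mult_l, Cpow_inv, <- RtoC_pow, hroot; [reflexivity |].
      intros h. apply RtoC_inj in h. revert h. apply Rgt_not_eq, exp_pos. }
    rewrite !hdiv.
    replace (INR l / INR l)%R with 1%R by (now field).
    rewrite Rpower_1 by exact hm0.
    field. apply hnz.
  - eapply filterlim_comp; [apply (pFq_confluence _ (x ^ l) hS) |].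
    apply (filterlim_scal_r (V := C_NormedModule) (x ^ i)).
Qed.
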